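(* Let $Q_1,Q_2,f_1,f_2,\mathcal{A},M,d_{Q_1},d_{Q_2},\mu$ be as in the context, fix $T\in\mathbb{N}_0$, and let the sequences $(x_t)_{t=0}^{T+1}$, $(u_t)_{t=0}^{T+1}$, $(z_t)_{t=0}^{T}$, $(\hat x_t)_{t=1}^{T+1}$, $(L_t)_{t=0}^{T}$ be generated by the algorithm described in the context with smoothness parameter $\mu>0$. Set \[ \bar x:=u_T\in Q_1,\qquad \bar y:=\sum_{t=0}^T\frac{2(t+1)}{(T+1)(T+2)}\,y_*(x_t)\in Q_2 . \] Then \[ \overline{\phi}(\bar x)-\underline{\phi}(\bar y)\le\frac{4\big(D_1\|\mathcal{A}\|^2/\mu+D_1M-\chi_T\big)}{(T+1)^2}+\mu D_2, \] where $\chi_T:=\sum_{t=0}^{T-1}(L_{t+1}-L_t)\big(d_{Q_1}(z_{t+1})-\tfrac12\|z_t-\hat x_{t+1}\|_{\mathbb{R}^n}^2\big)$, $D_1:=\max_{x\in Q_1}d_{Q_1}(x)$ and $D_2:=\max_{y\in Q_2}d_{Q_2}(y)$.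
   Context: $\mathbb{R}^n$ and $\mathbb{R}^m$ carry the standard scalar product $\langle\cdot,\cdot\rangle$ and norms $\|\cdot\|_{\mathbb{R}^n}$, $\|\cdot\|_{\mathbb{R}^m}$ (possibly not Euclidean). $Q_1\subset\mathbb{R}^n$, $Q_2\subset\mathbb{R}^m$ are compact convex. $f_1:\mathbb{R}^n\to\mathbb{R}$ and $f_2:\mathbb{R}^m\to\mathbb{R}$ are smooth convex functions, with $\nabla f_1$ Lipschitz continuous with constant $M>0$ (w.r.t. $\|\cdot\|_{\mathbb{R}^n}$ and its dual norm). $\mathcal{A}:\mathbb{R}^n\to\mathbb{R}^m$ is linear, $\|\mathcal{A}\|:=\max\{\langle\mathcal{A}x,y\rangle:\|x\|_{\mathbb{R}^n}=1,\|y\|_{\mathbb{R}^m}=1\}$, and $\mathcal{A}^*$ is its adjoint. Let $\phi(x,y)=f_1(x)+\langle\mathcal{A}x,y\rangle-f_2(y)$, $\overline{\phi}(x)=\max_{y\in Q_2}\phi(x,y)$, $\underline{\phi}(y)=\min_{x\in Q_1}\phi(x,y)$. A distance-generating function for a closed convex set $Q$ (in a normed space) is $d_Q:Q\to\mathbb{R}_{\ge0}$ that is continuous, strongly convex with modulus 1 w.r.t. the norm, and whose subdifferential admits a continuous selection $d_Q'$ on $Q^o=\{x\in Q:\partial d_Q(x)\ne\emptyset\}$; $V_z(x)=d_Q(x)-d_Q(z)-\langle d_Q'(z),x-z\rangle$, $\mathrm{Prox}_{Q,z}(s)=\arg\min_{x\in Q}\{\langle s,x-z\rangle+V_z(x)\}$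 for $z\in Q^o$, and $c(d_Q)=\arg\min_Q d_Q$, with $d_Q(c(d_Q))=0$ assumed. Let $d_{Q_1},d_{Q_2}$ be distance-generating functions for $Q_1,Q_2$. For $\mu>0$ set $\overline{\phi}_\mu(x)=\max_{y\in Q_2}\{f_1(x)+\langle\mathcal{A}x,y\rangle-f_2(y)-\mu d_{Q_2}(y)\}$ and let $y_*(x)$ be the unique maximizer. Then $\overline{\phi}_\mu$ is convex and differentiable with $\nabla\overline{\phi}_\mu(x)=\nabla f_1(x)+\mathcal{A}^*y_*(x)$, Lipschitz with constant $L_\mu:=M+\|\mathcal{A}\|^2/\mu$. Algorithm: set $L_0=L_\mu$, $x_0=c(d_{Q_1})$, $u_0=\arg\min_{x\in Q_1}\{\frac12(\overline{\phi}_\mu(x_0)+\langle\nabla\overline{\phi}_\mu(x_0),x-x_0\rangle)+L_0d_{Q_1}(x)\}$, $z_0=u_0$, $\tau_0=2/3$, $x_1=\tau_0z_0+(1-\tau_0)u_0$, $\hat x_1=\mathrm{Prox}_{Q_1,z_0}(\nabla\overline{\phi}_\mu(x_1)/L_0)$, $u_1=\tau_0\hat x_1+(1-\tau_0)u_0$. For $t=1,\dots,T$: choose $0<L_t\le L_\mu$ with $\overline{\phi}_\mu(u_t)\le\overline{\phi}_\mu(x_t)+\langle\nabla\overline{\phi}_\mu(x_t),u_t-x_t\rangle+\frac{L_t}{2}\|u_t-x_t\|_{\mathbb{R}^n}^2$; set $z_t=\arg\min_{x\in Q_1}\{\sum_{k=0}^t\frac{k+1}{2}(\overline{\phi}_\mu(x_k)+\langle\nabla\overline{\phi}_\mu(x_k),x-x_k\rangle)+L_td_{Q_1}(x)\}$;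 set $\tau_t=\frac{2}{t+3}$, $x_{t+1}=\tau_tz_t+(1-\tau_t)u_t$, $\hat x_{t+1}=\mathrm{Prox}_{Q_1,z_t}(\frac{t+2}{2}\nabla\overline{\phi}_\mu(x_{t+1})/L_t)$, $u_{t+1}=\tau_t\hat x_{t+1}+(1-\tau_t)u_t$. *)

(* Defs.v *)
From HB Require Import structures.
From mathcomp Require Import all_boot all_order all_algebra.
From mathcomp Require Import all_classical all_reals all_analysis.
Set Implicit Arguments. Unset Strict Implicit. Unset Printing Implicit Defensive.
Import Order.TTheory GRing.Theory Num.Theory.
Import numFieldNormedType.Exports.
Local Open Scope classical_set_scope.
Local Open Scope ring_scope.

Section Defs.
Variable R : realType.

Definition dot (k : nat) (u v : 'rV[R]_k) : R := \sum_(i < k) u ord0 i * v ord0 i.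

Definition is_norm (k : nat) (N : 'rV[R]_k -> R) : Prop :=
  [/\ forall x, 0 <= N x,
      forall x, N x = 0 -> x = 0,
      forall (a : R) x, N (a *: x) = `|a| * N x
    & forall x y, N (x + y) <= N x + N y].

Definition dual_norm (k : nat) (N : 'rV[R]_k -> R) (s : 'rV[R]_k) : R :=
  sup [set r | exists x, N x <= 1 /\ r = dot s x].

(* operator norm ||A|| = max { <A x, y> : ||x|| = 1, ||y|| = 1 };
   A x is represented as x *m A, the adjoint A^* y as y *m A^T *)
Definition op_norm (n m : nat) (N1 : 'rV[R]_n -> R) (N2 : 'rV[R]_m -> R)
  (A : 'M[R]_(n, m)) : R :=
  sup [set r | exists x y, N1 x = 1 /\ N2 y = 1 /\ r = dot (x *m A) y].

Definition convex_fun (k : nat) (f : 'rV[R]_k -> R) : Prop :=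
  forall x y (l : R), 0 <= l <= 1 ->
    f (l *: x + (1 - l) *: y) <= l * f x + (1 - l) * f y.

Definition maxQ (k : nat) (Q : set 'rV[R]_k) (F : 'rV[R]_k -> R) : R := sup (F @` Q).
Definition minQ (k : nat) (Q : set 'rV[R]_k) (F : 'rV[R]_k -> R) : R := inf (F @` Q).

Definition is_argmin (k : nat) (Q : set 'rV[R]_k) (F : 'rV[R]_k -> R) (x : 'rV[R]_k) :=
  Q x /\ forall y, Q y -> F x <= F y.
Definition is_argmax (k : nat) (Q : set 'rV[R]_k) (F : 'rV[R]_k -> R) (x : 'rV[R]_k) :=
  Q x /\ forall y, Q y -> F y <= F x.

Definition subdiff (k : nat) (Q : set 'rV[R]_k) (d : 'rV[R]_k -> R) (x s : 'rV[R]_k) :=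
  Q x /\ forall y, Q y -> d x + dot s (y - x) <= d y.

Definition Qo (k : nat) (Q : set 'rV[R]_k) (d : 'rV[R]_k -> R) : set 'rV[R]_k :=
  [set x | Q x /\ exists s, subdiff Q d x s].

Definition is_dgf (k : nat) (N : 'rV[R]_k -> R) (Q : set 'rV[R]_k)
  (d : 'rV[R]_k -> R) (d' : 'rV[R]_k -> 'rV[R]_k) : Prop :=
  [/\ forall x, Q x -> 0 <= d x,
      {within Q, continuous d},
      (forall x y (l : R), Q x -> Q y -> 0 <= l <= 1 ->
         d (l *: x + (1 - l) *: y)
           <= l * d x + (1 - l) * d y - 2^-1 * l * (1 - l) * N (x - y) ^+ 2),
      (forall x, Qo Q d x -> subdiff Q d x (d' x))
    & {within Qo Q d, continuous d'}].

Definition bregman (k : nat) (d : 'rV[R]_k -> R) (d' : 'rV[R]_k -> 'rV[R]_k)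
  (z x : 'rV[R]_k) : R := d x - d z - dot (d' z) (x - z).

Definition is_prox (k : nat) (Q : set 'rV[R]_k) (d : 'rV[R]_k -> R)
  (d' : 'rV[R]_k -> 'rV[R]_k) (z s p : 'rV[R]_k) : Prop :=
  is_argmin Q (fun x => dot s (x - z) + bregman d d' z x) p.

End Defs.

(* Main.v *)
Require Import Defs.
From HB Require Import structures.
From mathcomp Require Import all_boot all_order all_algebra.
From mathcomp Require Import all_classical all_reals all_analysis.
From mathcomp Require Import ring lra.
Import Order.TTheory GRing.Theory Num.Theory.
Import numFieldNormedType.Exports.
Local Open Scope classical_set_scope.
Local Open Scope ring_scope.
Set Implicit Arguments. Unset Strict Implicit. Unset Printing Implicit Defensive.

(* The smoothed primal function [phimu] is convex, and satisfies the quadratic upper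
   bound with constant [Lmu] because the maximizer [ys] of a [mu]-strongly concave
   problem absorbs the cross term [<A(w - v), ys w - ys v>]. The accelerated scheme is
   then analysed by an estimate sequence: with [W t = (t+1)(t+2)/4], one shows
   [W t * phimu (u t) + chi_t <= min over Q1 of
    \sum_(k <= t) (k+1)/2 * (linearization of phimu at x k) + L t * d1],
   the minimum being attained at [z t]. Each linearization is dominated by
   [phi _ (ys (x k))], so concavity of [phi] in its second argument turns the weighted
   sum into [phi _ ybar], which gives the duality gap up to the smoothing error [mu * D2].
   Evaluating the same estimate at [u T] shows that [Lmu * D1 - chi] is nonnegative, so
   [1 / W T] may be weakened to [4 / (T+1)^2]. *)

(** * Scalar product and estimates in the maximum norm *)

Lemma dotE (R : realType) k (u v : 'rV[R]_k) : dot u v = (u *m v^T) ord0 ord0.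
Proof. by rewrite mxE; apply: eq_bigr => i _; rewrite mxE. Qed.

Lemma dotDl (R : realType) k (u v w : 'rV[R]_k) :
  dot (u + v) w = dot u w + dot v w.
Proof. by rewrite !dotE mulmxDl mxE. Qed.

Lemma dotDr (R : realType) k (w u v : 'rV[R]_k) :
  dot w (u + v) = dot w u + dot w v.
Proof. by rewrite !dotE linearD mulmxDr mxE. Qed.

Lemma dotZl (R : realType) k a (u v : 'rV[R]_k) : dot (a *: u) v = a * dot u v.
Proof. by rewrite !dotE -scalemxAl mxE. Qed.

Lemma dotZr (R : realType) k a (u v : 'rV[R]_k) : dot u (a *: v) = a * dot u v.
Proof. by rewrite !dotE linearZ -scalemxAr mxE. Qed.

Lemma dotNl (R : realType) k (u v : 'rV[R]_k) : dot (- u) v = - dot u v.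
Proof. by rewrite -scaleN1r dotZl mulN1r. Qed.

Lemma dotNr (R : realType) k (u v : 'rV[R]_k) : dot u (- v) = - dot u v.
Proof. by rewrite -scaleN1r dotZr mulN1r. Qed.

Lemma dot0l (R : realType) k (u : 'rV[R]_k) : dot 0 u = 0.
Proof. by rewrite !dotE mul0mx mxE. Qed.

Lemma dot0r (R : realType) k (u : 'rV[R]_k) : dot u 0 = 0.
Proof. by rewrite !dotE trmx0 mulmx0 mxE. Qed.

Lemma dot_sumr (R : realType) k (w : 'rV[R]_k) (v : nat -> 'rV[R]_k) (s : seq nat) :
  dot w (\sum_(i <- s) v i) = \sum_(i <- s) dot w (v i).
Proof. by rewrite (big_morph (dot w) (dotDr w) (dot0r w)). Qed.

Lemma dot_suml (R : realType) k (w : 'rV[R]_k) (v : nat -> 'rV[R]_k) (s : seq nat) :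
  dot (\sum_(i <- s) v i) w = \sum_(i <- s) dot (v i) w.
Proof.
by apply: (big_ind2 (fun a b => dot a w = b)) => [|? ? ? ? <- <-|//];
  rewrite ?dot0l ?dotDl.
Qed.

Lemma dot_mulmx (R : realType) n m (A : 'M[R]_(n, m)) (v : 'rV[R]_n) (w : 'rV[R]_m) :
  dot (w *m A^T) v = dot (v *m A) w.
Proof.
by rewrite !dotE -mulmxA -trmx_mul -{1}[w]trmxK -trmx_mul mxE.
Qed.

Lemma ler_entry_norm (R : realType) k (x : 'rV[R]_k) i : `|x ord0 i| <= `|x|.
Proof.
rewrite [leRHS]/Num.norm /= mx_normrE; apply/bigmax_geP; right.
by exists (ord0, i).
Qed.

Lemma dot_norm_le (R : realType) k (u v : 'rV[R]_k) :
  `|dot u v| <= k%:R * (`|u| * `|v|).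
Proof.
apply: (le_trans (ler_norm_sum _ _ _)).
rewrite mulr_natl -[X in _ *+ X](card_ord k) -sumr_const ler_sum// => i _.
by rewrite normrM ler_pM ?ler_entry_norm.
Qed.

Lemma norm_mulmx_le (R : realType) n m (A : 'M[R]_(n, m)) :
  exists2 C : R, 0 <= C & forall x : 'rV[R]_n, `|x *m A| <= C * `|x|.
Proof.
have key C : 0 <= C -> forall x : 'rV[R]_n,
    (forall j, `|(x *m A) ord0 j| <= C) -> `|x *m A| <= C.
  move=> C0 x h; rewrite [leLHS]/Num.norm /= mx_normrE.
  apply/bigmax_leP; split => // -[i j] _ /=.
  by rewrite (ord1 i).
exists (\sum_i \sum_j `|A i j|).
  by apply: sumr_ge0 => i _; apply: sumr_ge0.
move=> x; apply: key.
  by rewrite mulr_ge0//; apply: sumr_ge0 => i _; apply: sumr_ge0.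
move=> j; rewrite mxE (le_trans (ler_norm_sum _ _ _))// mulr_suml ler_sum// => i _.
rewrite normrM mulrC ler_pM ?ler_entry_norm//.
by rewrite (bigD1 j)//= lerDl sumr_ge0.
Qed.

(** * Arbitrary norms, their duals and the operator norm *)

Section Norm.
Variables (R : realType) (k : nat) (N : 'rV[R]_k -> R).
Hypothesis NN : is_norm N.

Lemma is_norm0 : N 0 = 0.
Proof. by case: NN => _ _ NZ _; rewrite -(scale0r 0) NZ normr0 mul0r. Qed.

Lemma is_normN x : N (- x) = N x.
Proof. by case: NN => _ _ NZ _; rewrite -scaleN1r NZ normrN1 mul1r. Qed.

Lemma is_normB x y : N (x - y) = N (y - x).
Proof. by rewrite -is_normN opprB. Qed.

Lemma is_norm_le_norm : exists2 B, 0 <= B & forall x, N x <= B * `|x|.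
Proof.
case: NN => N0 Neq0 NZ ND.
exists (\sum_i N (delta_mx ord0 i)); first exact: sumr_ge0.
move=> x; rewrite {1}(row_sum_delta x) mulr_suml.
elim/big_ind2 : _ => [|a b c d le1 le2|i _].
- by rewrite is_norm0.
- exact: le_trans (ND _ _) (lerD le1 le2).
- by rewrite NZ mulrC ler_wpM2l ?ler_entry_norm.
Qed.

Lemma is_norm_continuous : continuous N.
Proof.
case: NN => N0 Neq0 NZ ND; have [B B0 NB] := is_norm_le_norm.
have B1 : 0 < B + 1 by lra.
have dist x y : `|N x - N y| <= B * `|x - y|.
  apply: le_trans (NB (x - y)); rewrite ler_norml.
  have := ND (x - y) y; have := ND (y - x) x; rewrite !subrK (is_normB y).
  by move=> ? ?; apply/andP; split; lra.
move=> x; apply/(@cvgrPdist_lt _ _ _ (nbhs x)) => e e0; near=> y.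
apply: (le_lt_trans (dist x y)).
have : `|x - y| < e / (B + 1).
  near: y; apply/nbhs_ballP; exists (e / (B + 1)) => /=; first exact: divr_gt0.
  by move=> y; rewrite -ball_normE.
rewrite ltr_pdivlMr// => h; apply: le_lt_trans h.
by rewrite mulrC ler_wpM2l// lerDl.
Unshelve. all: by end_near. Qed.

(** The unit sphere of the maximum norm is compact, so the continuous [N] attains a positive minimum
    there; its inverse serves as [C]. *)
Lemma norm_le_is_norm : exists2 C, 0 < C & forall x, `|x| <= C * N x.
Proof.
case: NN => N0 Neq0 NZ ND.
pose S := [set x : 'rV[R]_k | `|x| = 1].
have scaled C x : 0 < C -> (forall y, S y -> 1 <= C * N y) -> `|x| <= C * N x.
  move=> C0 h; have [->|x0] := eqVneq x 0; first by rewrite normr0 mulr_ge0 ?(ltW C0).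
  have nx0 : 0 < `|x| by rewrite normr_gt0.
  have /h : S (`|x|^-1 *: x).
    by rewrite /S/= normrZ ger0_norm ?invr_ge0// mulVf// gt_eqF.
  by rewrite NZ ger0_norm ?invr_ge0// mulrCA -ler_pdivrMl ?invr_gt0// invrK mulr1.
(* The sphere is empty exactly when [k] is 0; any positive constant then works. *)
have [S0|nS] := pselect (S !=set0); last first.
  by exists 1 => // x; apply: scaled => // y Sy; exfalso; apply: nS; exists y.
have cS : compact S.
  apply: bounded_closed_compact.
    exists 1; split => // M M1 x; rewrite /S/= => ->; exact: ltW.
  have -> : S = (fun x : 'rV[R]_k => `|x|) @^-1` [set 1] by [].
  by apply: closed_comp => [x _|]; [exact: norm_continuous | exact: closed_eq].
have [c] := EVT_min_rV S0 cS (continuous_subspaceT is_norm_continuous).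
rewrite inE => Sc cmin.
have Nc : 0 < N c.
  rewrite lt_neqAle N0 andbT eq_sym; apply/eqP => /Neq0 c0.
  by move: Sc; rewrite /S/= c0 normr0 => /eqP; rewrite eq_sym oner_eq0.
exists (N c)^-1; first by rewrite invr_gt0.
move=> x; apply: scaled; first by rewrite invr_gt0.
by move=> y Sy; rewrite mulrC ler_pdivlMr// mul1r cmin// inE.
Qed.

(** A [sup] dominates the elements of its set only if that set is bounded above; equivalence of
    norms provides the bound, and normalizing [x] the element. *)
Lemma dot_le_dual_norm s x : dot s x <= dual_norm N s * N x.
Proof.
case: (NN) => N0 Neq0 NZ ND.
have [C C0 NC] := norm_le_is_norm.
have ub : has_ubound [set r | exists x, N x <= 1 /\ r = dot s x].
  exists (k%:R * (`|s| * C)) => _ [y [Ny ->]].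
  apply: (le_trans (ler_norm _)); apply: (le_trans (dot_norm_le _ _)).
  rewrite !ler_wpM2l//; apply: (le_trans (NC y)).
  by rewrite -[leRHS]mulr1 ler_wpM2l// ltW.
have [->|x0] := eqVneq x 0; first by rewrite dot0r is_norm0 mulr0.
have Nx : 0 < N x.
  by rewrite lt_neqAle N0 andbT eq_sym; apply: contra_neq x0 => /Neq0.
rewrite -ler_pdivrMr// mulrC -dotZr.
apply: ub_le_sup => //; exists ((N x)^-1 *: x); split => //.
by rewrite NZ ger0_norm ?invr_ge0 ?(ltW Nx)// mulVf// gt_eqF.
Qed.

End Norm.

Lemma dot_le_op_norm (R : realType) n m (N1 : 'rV[R]_n -> R) (N2 : 'rV[R]_m -> R)
  (A : 'M[R]_(n, m)) x y : is_norm N1 -> is_norm N2 ->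
  dot (x *m A) y <= op_norm N1 N2 A * N1 x * N2 y.
Proof.
move=> NN1 NN2.
have [C1 C10 NC1] := norm_le_is_norm NN1.
have [C2 C20 NC2] := norm_le_is_norm NN2.
have [K K0 AK] := norm_mulmx_le A.
case: (NN1) => N10 N1eq0 N1Z _; case: (NN2) => N20 N2eq0 N2Z _.
have ub : has_ubound [set r | exists x y, N1 x = 1 /\ N2 y = 1 /\ r = dot (x *m A) y].
  exists (m%:R * (K * C1 * C2)) => _ [v [w [Nv [Nw ->]]]].
  apply: (le_trans (ler_norm _)); apply: (le_trans (dot_norm_le _ _)).
  rewrite ler_wpM2l// ler_pM//.
  - apply: (le_trans (AK v)); rewrite ler_wpM2l//.
    by apply: (le_trans (NC1 v)); rewrite Nv mulr1.
  - by apply: (le_trans (NC2 w)); rewrite Nw mulr1.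
(* [op_norm] ranges over unit vectors only, so zero vectors, which cannot be normalized, are treated
   apart. *)
have [->|x0] := eqVneq x 0.
  by rewrite mul0mx dot0l (is_norm0 NN1) mulr0 mul0r.
have [->|y0] := eqVneq y 0; first by rewrite dot0r (is_norm0 NN2) mulr0.
have Nx : 0 < N1 x.
  by rewrite lt_neqAle N10 andbT eq_sym; apply: contra_neq x0 => /N1eq0.
have Ny : 0 < N2 y.
  by rewrite lt_neqAle N20 andbT eq_sym; apply: contra_neq y0 => /N2eq0.
rewrite -ler_pdivrMr// -ler_pdivrMr// [leLHS]mulrC [X in _ * X]mulrC -dotZr -dotZl.
rewrite scalemxAl; apply: ub_le_sup => //.
exists ((N1 x)^-1 *: x), ((N2 y)^-1 *: y).
rewrite N1Z N2Z !ger0_norm ?invr_ge0 ?(ltW Nx) ?(ltW Ny)//.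
by rewrite !mulVf// gt_eqF.
Qed.

(** * Segments, strong convexity and minimizers *)

Lemma segmentE (R : realType) k (x y : 'rV[R]_k) (l : R) :
  l *: x + (1 - l) *: y = y + l *: (x - y).
Proof. by rewrite scalerBl scale1r scalerBr addrCA. Qed.

(** This stands in for the limit [l] to 0 in first-order arguments: compare along a segment, divide
    by [l], and absorb the remainder in [l * q]. *)
Lemma le0_of_le_scaled (R : realFieldType) (p q : R) :
  (forall l, 0 < l <= 1 -> p <= l * q) -> p <= 0.
Proof.
move=> h; rewrite leNgt; apply/negP => p0.
have q0 : 0 < q by apply: (lt_le_trans p0); rewrite -[leRHS]mul1r h// ltr01/=.
(* This [l] gives [l * q <= p / 2], which contradicts [p <= l * q] for positive [p]. *)
have := h (Num.min 1 (p / (2 * q))).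
rewrite lt_min ltr01 ge_min lexx/= divr_gt0 ?mulr_gt0// => /(_ isT).
apply/negP; rewrite -ltNge.
apply: (@le_lt_trans _ _ (p / (2 * q) * q)).
  by rewrite ler_wpM2r ?(ltW q0)// ge_min lexx orbT.
by rewrite invfM mulrA divfK ?gt_eqF//; lra.
Qed.

Lemma convex_setP (R : realType) k (Q : set 'rV[R]_k) x y (l : R) :
  convex_set Q -> Q x -> Q y -> 0 <= l <= 1 -> Q (l *: x + (1 - l) *: y).
Proof.
move=> cQ Qx Qy /andP[l0 l1].
by have := cQ x y (Itv01 l0 l1) (mem_set Qx) (mem_set Qy); rewrite inE.
Qed.

Definition strongly_convex_on (R : realType) k (N : 'rV[R]_k -> R)
    (Q : set 'rV[R]_k) (F : 'rV[R]_k -> R) (s : R) :=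
  forall x y (l : R), Q x -> Q y -> 0 <= l <= 1 ->
    F (l *: x + (1 - l) *: y)
      <= l * F x + (1 - l) * F y - s * (2^-1 * l * (1 - l) * N (x - y) ^+ 2).

Lemma strongly_convex_argmin (R : realType) k (N : 'rV[R]_k -> R) Q F s z x :
  convex_set Q -> strongly_convex_on N Q F s -> is_argmin Q F z -> Q x ->
  F z + s * (2^-1 * N (x - z) ^+ 2) <= F x.
Proof.
move=> cQ sF [Qz zmin] Qx; rewrite -subr_le0.
apply: (@le0_of_le_scaled _ _ (s * (2^-1 * N (x - z) ^+ 2))) => l /andP[l0 l1].
have l01 : 0 <= l <= 1 by rewrite l1 ltW.
have := le_trans (zmin _ (convex_setP cQ Qx Qz l01)) (sF x z l Qx Qz l01).
by move=> h; rewrite -(ler_pM2l l0); nra.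
Qed.

(** Subtracting the linear form [dot s] keeps the modulus and makes [z] a minimizer, so quadratic
    growth at a minimizer applies. *)
Lemma subdiff_strongly_convex (R : realType) k (N : 'rV[R]_k -> R) Q d z s x :
  convex_set Q -> strongly_convex_on N Q d 1 -> subdiff Q d z s -> Q x ->
  d z + dot s (x - z) + 2^-1 * N (x - z) ^+ 2 <= d x.
Proof.
move=> cQ sd [Qz zs] Qx.
have sF : strongly_convex_on N Q (fun v => d v - dot s v) 1.
  move=> a b l Qa Qb l01; have := sd a b l Qa Qb l01.
  by rewrite dotDr !dotZr; lra.
have zmin : is_argmin Q (fun v => d v - dot s v) z.
  by split => // y /zs; rewrite dotDr dotNr; lra.
have := strongly_convex_argmin cQ sF zmin Qx.
by rewrite dotDr dotNr; lra.
Qed.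

Lemma normX2_le_dot (R : realType) k (v : 'rV[R]_k) : `|v| ^+ 2 <= dot v v.
Proof.
have v0 : 0 <= dot v v by apply: sumr_ge0 => i _; exact: sqr_ge0.
have [->|] := eqVneq `|v| 0; first by rewrite expr0n.
move=> /mx_norm_neq0[[i j] /=]; rewrite (ord1 i).
rewrite -[mx_norm v]/(`|v|) => ->.
rewrite real_normK ?num_real// /dot (bigD1 j)//= expr2 lerDl.
by apply: sumr_ge0 => ? _; exact: sqr_ge0.
Qed.

Lemma dot_self_continuous (R : realType) k (v : 'rV[R]_k) :
  continuous (fun w : 'rV[R]_k => dot (w - v) (w - v)).
Proof.
rewrite /dot; apply: continuous_big => [|i _ w].
  exact: add_continuous.
have c : (w' - v) ord0 i @[w' --> w] --> (w - v) ord0 i.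
  have -> : (fun w' : 'rV[R]_k => (w' - v) ord0 i) = (fun w' => w' ord0 i - v ord0 i).
    by apply/funext => w'; rewrite !mxE.
  rewrite !mxE; apply: (@cvgB _ R^o _ (nbhs w)); last exact: cvg_cst.
  exact: coord_continuous.
exact: (@cvgM _ _ (nbhs w)).
Qed.

(** * The continuous subgradient selection at minimizers *)

Section DistanceGenerating.
Variables (R : realType) (k : nat) (Q : set 'rV[R]_k) (d : 'rV[R]_k -> R).
Hypotheses (cQ : convex_set Q) (kQ : compact Q).
Hypothesis d_convex : forall x y (l : R), Q x -> Q y -> 0 <= l <= 1 ->
  d (l *: x + (1 - l) *: y) <= l * d x + (1 - l) * d y.

(* Minimize [d w + K * dot (w - v) (w - v)] for a large [K]: the minimizer [w] is close
   to [v], and [d] has the subgradient [- 2 K (w - v)] there. *)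
Lemma Qo_dense v e : {within Q, continuous d} -> (forall x, Q x -> 0 <= d x) ->
  Q v -> 0 < e -> exists2 w, Qo Q d w & `|w - v| <= e.
Proof.
move=> dc d0 Qv e0.
(* Comparison with [v] will give [K * |w - v|^2 <= d v], hence [|w - v| <= e]; the summand 1 keeps
   [K] positive when [d v] is 0. *)
pose K := (d v + 1) / e ^+ 2.
have dv0 := d0 _ Qv.
have K0 : 0 < K by rewrite divr_gt0 ?exprn_gt0//; lra.
pose F w := d w + K * dot (w - v) (w - v).
have cF : {within Q, continuous F}.
  apply/subspace_continuousP => w Qw.
  apply: (@cvgD _ R^o _ (within Q (nbhs w))).
    by move/subspace_continuousP : dc; apply.
  apply: (@cvgM _ _ (within Q (nbhs w))); first exact: cvg_cst.
  by apply: cvg_within_filter; exact: dot_self_continuous.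
have [w] := EVT_min_rV (ex_intro _ v Qv) kQ cF.
rewrite inE => Qw wmin; exists w.
  split => //; exists (- (2 * K) *: (w - v)); split => // y Qy.
  rewrite -subr_le0.
  apply: (@le0_of_le_scaled _ _ (K * dot (y - w) (y - w))) => l /andP[l0 l1].
  have l01 : 0 <= l <= 1 by rewrite l1 ltW.
  have Qp := convex_setP cQ Qy Qw l01.
  have h1 := wmin _ (mem_set Qp); have h2 := d_convex Qy Qw l01.
  rewrite -(ler_pM2l l0); move: h1; rewrite /F segmentE in h2 *.
  have -> : w + l *: (y - w) - v = (w - v) + l *: (y - w) by rewrite addrAC.
  rewrite !(dotDl (w - v)) !(dotDr _ (w - v)) !dotZl !dotZr.
  have -> : dot (y - w) (w - v) = dot (w - v) (y - w).
    by apply: eq_bigr => i _; rewrite mulrC.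
  by move=> h1; nra.
have := wmin _ (mem_set Qv); rewrite /F subrr dot0l mulr0 addr0 => h.
have dw0 := d0 _ Qw.
have h1 : K * `|w - v| ^+ 2 <= d v.
  apply: (@le_trans _ _ (K * dot (w - v) (w - v))); last by lra.
  by rewrite ler_pM2l// normX2_le_dot.
rewrite -(ler_pXn2r (ltn0Sn 1)) ?nnegrE ?(ltW e0)//.
rewrite -(ler_pM2l K0); apply: (le_trans h1).
by rewrite /K divfK ?expf_neq0 ?gt_eqF//; lra.
Qed.

(* At a minimizer [z] some subgradient satisfies this inequality trivially, but [d' z]
   need not be that one. Continuity of the selection decides: points [w] of [Qo] close to
   [z + l (x - z)] satisfy [0 <= dot (s + d' w) (w - z)], and [l] tends to 0. *)
Lemma argmin_Qo_selection (d' : 'rV[R]_k -> 'rV[R]_k) s z x :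
  {within Q, continuous d} -> (forall x, Q x -> 0 <= d x) ->
  (forall x, Qo Q d x -> subdiff Q d x (d' x)) -> {within Qo Q d, continuous d'} ->
  is_argmin Q (fun v => dot s v + d v) z -> Q x ->
  0 <= dot (s + d' z) (x - z).
Proof.
move=> dc d0 d'sub d'c [Qz zmin] Qx.
have Qoz : Qo Q d z.
  split => //; exists (- s); split => // y /zmin.
  by rewrite dotNl dotDr dotNr; lra.
set b := `|x - z|; set a := `|s + d' z|.
have [a0 b0] : 0 <= a /\ 0 <= b by split; exact: normr_ge0.
rewrite -oppr_le0.
(* The same [e] bounds the variation of [d'] near [z] and, times [l], the distance from [w] to the
   segment point; the two errors add up to [l * e * k * (a + b + 1)]. *)
apply: (@le0_of_le_scaled _ _ (k%:R * (a + b + 1))) => e /andP[e0 e1].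
have /subspace_continuousP/(_ z Qoz)/cvgrPdist_lt/(_ e e0) := d'c.
rewrite near_withinE => /nbhs_ballP[dl /= dl0 hdl].
pose m := Num.min dl 1.
have m0 : 0 < m by rewrite lt_min dl0 ltr01.
have m1 : m <= 1 by rewrite ge_min lexx orbT.
have mdl : m <= dl by rewrite ge_min lexx.
(* Since [e <= 1], this puts [w] within [l * (b + e) < m <= dl] of [z], where the continuity
   estimate for [d'] holds. *)
pose l := m / (b + 2).
have b2 : 0 < b + 2 by lra.
have l0 : 0 < l by rewrite divr_gt0.
have lb : l * (b + 2) = m by rewrite divfK// gt_eqF.
have l1 : l <= 1 by rewrite ler_pdivrMr//; lra.
have l01 : 0 <= l <= 1 by rewrite l1 ltW.
have Qp := convex_setP cQ Qx Qz l01; have le0 : 0 < l * e by rewrite mulr_gt0.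
have [w Qow wp] := Qo_dense dc d0 Qp le0.
rewrite segmentE in wp; set r := w - (z + l *: (x - z)) in wp.
have wz : w - z = l *: (x - z) + r.
  by rewrite /r [RHS]addrC opprD addrA subrK.
have nwz : `|w - z| <= l * (b + e).
  rewrite wz (le_trans (ler_normD _ _))// normrZ gtr0_norm// mulrDr.
  by rewrite lerD.
have hw : `|d' z - d' w| < e.
  apply: hdl => //; rewrite -ball_normE/= distrC (le_lt_trans nwz)//.
  by apply: lt_le_trans mdl; rewrite -lb ltr_pM2l//; lra.
have [Qw _] := Qow.
(* Add the minimality of [z], tested at [w], to the subgradient inequality at [w], tested at [z]. *)
have h0 : 0 <= dot (s + d' w) (w - z).
  have [_ /(_ _ Qz)] := d'sub _ Qow; have := zmin _ Qw.
  by rewrite !dotDl !dotDr !dotNr; lra.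
have split3 : dot (s + d' w) (w - z) =
    l * dot (s + d' z) (x - z) + dot (s + d' z) r - dot (d' z - d' w) (w - z).
  rewrite -dotZr -dotDr -wz -dotNl -dotDl; congr (dot _ _).
  by rewrite opprB [RHS]addrC addrACA addNr addr0 addrC.
have b1 : dot (s + d' z) r <= k%:R * (a * (l * e)).
  apply: (le_trans (ler_norm _)); apply: (le_trans (dot_norm_le _ _)).
  by rewrite !ler_wpM2l.
have b3 : - dot (d' z - d' w) (w - z) <= k%:R * (e * (l * (b + e))).
  rewrite -dotNr; apply: (le_trans (ler_norm _)).
  apply: (le_trans (dot_norm_le _ _)); rewrite normrN.
  by rewrite ler_wpM2l// ler_pM// ltW.
rewrite -(ler_pM2l l0).
have k0 : 0 <= k%:R :> R by [].
have : k%:R * (e * (l * (b + e))) <= k%:R * (e * (l * (b + 1))).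
  by rewrite ler_wpM2l// (ler_pM2l e0) (ler_pM2l l0) lerD2l.
by nra.
Qed.

End DistanceGenerating.

(** * First-order bounds for differentiable functions, and attained maxima *)

Lemma convex_diff_le (R : realType) k (f : 'rV[R]_k -> R) v w :
  convex_fun f -> differentiable f v -> f v + 'd f v (w - v) <= f w.
Proof.
move=> cf df; rewrite -deriveE//.
rewrite addrC -lerBrDr.
have dv : derivable f v (w - v) by exact: diff_derivable.
apply: (cvgr_to_le (cvg_dnbhs_at_right dv)).
near=> h.
have h0 : 0 < h by near: h; exact: nbhs_right_gt.
have h1 : h <= 1 by near: h; exact: nbhs_right_le.
rewrite -[leLHS]/(h^-1 * (f (h *: (w - v) + v) - f v)) mulrC ler_pdivrMr// lerBlDr.
have := cf w v h; rewrite h1 ltW// => /(_ isT).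
by rewrite segmentE addrC => /le_trans; apply; lra.
Unshelve. all: by end_near. Qed.

Lemma is_derive_line (R : realType) k (f : 'rV[R]_k -> R) x v (s : R) :
  differentiable f (x + s *: v) ->
  is_derive s (1 : R) (fun t : R => f (x + t *: v)) ('d f (x + s *: v) v).
Proof.
move=> df; have dv : derivable f (x + s *: v) v by exact: diff_derivable.
rewrite -deriveE//.
have E : (fun h : R => h^-1 *: (((fun t : R => f (x + t *: v)) \o shift s) (h *: (1 : R))
      - f (x + s *: v))) =
    (fun h : R => h^-1 *: ((f \o shift (x + s *: v)) (h *: v) - f (x + s *: v))).
  apply/funext => h /=; congr (_ *: (f _ - _)).
  by rewrite [h *: 1]mulr1 scalerDl addrCA.
by split; rewrite /derivable /derive E.
Qed.

(** The mean value theorem replaces integration: after subtracting [c * s + K * s ^+ 2] from [f]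
    along the segment, the Lipschitz bound makes the derivative nonpositive on the open unit
    interval. *)
Lemma descent_lemma (R : realType) k (N : 'rV[R]_k -> R) (f : 'rV[R]_k -> R)
    (g : 'rV[R]_k -> 'rV[R]_k) (M : R) x y :
  is_norm N -> (forall v, differentiable f v) ->
  (forall v h, 'd f v h = dot (g v) h) ->
  (forall v w, dual_norm N (g v - g w) <= M * N (v - w)) ->
  f y <= f x + dot (g x) (y - x) + M / 2 * N (y - x) ^+ 2.
Proof.
move=> NN df dg gM; set v := y - x.
pose c := dot (g x) v; pose K := M / 2 * N v ^+ 2.
pose h (s : R) := f (x + s *: v) - (c * s + K * s ^+ 2).
have dh s : is_derive s (1 : R) h (dot (g (x + s *: v)) v - (c + 2 * K * s)).
  have d1 := is_derive_line (df (x + s *: v)).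
  have d2 : is_derive s (1 : R) (fun t : R => c * t + K * t ^+ 2) (c + 2 * K * s).
    apply: is_derive_eq; rewrite /GRing.scale/=; ring.
  rewrite -dg; exact: is_deriveB.
have ch : {within `[0, 1], continuous h}.
  apply: continuous_subspaceT => s; apply: differentiable_continuous.
  by apply/derivable1_diffP; exact: (@ex_derive _ _ _ _ _ _ _ (dh s)).
have [s s01 hs] := MVT ltr01 (fun s _ => dh s) ch.
have [s0 s1] : 0 < s /\ s < 1 by move: s01; rewrite in_itv/= => /andP[].
have : dot (g (x + s *: v) - g x) v <= M * s * N v ^+ 2.
  apply: (le_trans (dot_le_dual_norm NN _ _)).
  have [N0 _ NZ _] := NN.
  apply: (le_trans (ler_wpM2r (N0 v) (gM _ _))).
  rewrite addrAC subrr add0r NZ gtr0_norm//; lra.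
have e1 : x + 1 *: v = y by rewrite scale1r addrC subrK.
have e0 : x + 0 *: v = x by rewrite scale0r addr0.
by move: hs; rewrite /h e1 e0 /K /c dotDl dotNl; lra.
Qed.

Lemma maxQ_argmax (R : realType) k (Q : set 'rV[R]_k) F x :
  is_argmax Q F x -> maxQ Q F = F x.
Proof.
move=> [Qx xmax]; apply/eqP; rewrite eq_le; apply/andP; split.
  by apply: ge_sup => [|_ [y Qy <-]]; [exists (F x), x | exact: xmax].
by apply: ub_le_sup; [exists (F x) => _ [y Qy <-]; exact: xmax | exists x].
Qed.

Lemma le_maxQ (R : realType) k (Q : set 'rV[R]_k) F x :
  compact Q -> {within Q, continuous F} -> Q x -> F x <= maxQ Q F.
Proof.
move=> kQ cF Qx.
have [c] := EVT_max_rV (ex_intro _ x Qx) kQ cF; rewrite inE => Qc cmax.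
have cm : is_argmax Q F c by split => // y Qy; apply: cmax; rewrite inE.
by rewrite (maxQ_argmax cm); case: cm => _; apply.
Qed.

Lemma is_dgf_strongly_convex (R : realType) k (N : 'rV[R]_k -> R) Q d d' :
  is_dgf N Q d d' -> strongly_convex_on N Q d 1.
Proof. by move=> [_ _ sd _ _] x y l Qx Qy l01; rewrite mul1r; exact: sd. Qed.

Lemma is_dgf_convex (R : realType) k (N : 'rV[R]_k -> R) Q d d' x y (l : R) :
  is_dgf N Q d d' -> Q x -> Q y -> 0 <= l <= 1 ->
  d (l *: x + (1 - l) *: y) <= l * d x + (1 - l) * d y.
Proof.
move=> [_ _ sd _ _] Qx Qy /[dup] l01 /andP[l0 l1].
apply: (le_trans (sd x y l Qx Qy l01)); rewrite gerBl.
by rewrite mulr_ge0 ?sqr_ge0// mulr_ge0 ?subr_ge0// mulr_ge0.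
Qed.

(** * Bregman distances and one step of the estimate sequence *)

Section Prox.
Variables (R : realType) (k : nat) (N : 'rV[R]_k -> R) (Q : set 'rV[R]_k).
Variables (d : 'rV[R]_k -> R) (d' : 'rV[R]_k -> 'rV[R]_k).
Hypotheses (NN : is_norm N) (cQ : convex_set Q) (kQ : compact Q).
Hypothesis dgf : is_dgf N Q d d'.

Lemma argmin_Qo (L c : R) s z : 0 < L ->
  is_argmin Q (fun v => c + dot s v + L * d v) z -> Qo Q d z.
Proof.
move=> L0 [Qz zmin]; split => //; exists (- (L^-1 *: s)); split => // y /zmin h.
rewrite dotNl dotZl dotDr dotNr -(ler_pM2l L0) mulrDr mulrN mulrA mulfV ?gt_eqF//.
by lra.
Qed.

(** Optimality directly yields the subgradient [- L^-1 *: s] at [z], whereas [bregman] involves the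
    selected [d' z]; [argmin_Qo_selection] bridges the two. *)
Lemma argmin_bregman (L c : R) s z x : 0 < L ->
  is_argmin Q (fun v => c + dot s v + L * d v) z -> Q x ->
  dot s z + L * d z + L * bregman d d' z x <= dot s x + L * d x.
Proof.
move=> L0 [Qz zmin] Qx; have [d0 dc _ dsub d'c] := dgf.
have zmin' : is_argmin Q (fun v => dot (L^-1 *: s) v + d v) z.
  split => // y /zmin h.
  by rewrite !dotZl -(ler_pM2l L0) !mulrDr !mulrA mulfV ?gt_eqF//; lra.
have := argmin_Qo_selection cQ kQ (fun x y l => is_dgf_convex dgf) dc d0 dsub d'c
  zmin' Qx.
rewrite -(pmulr_rge0 _ L0) dotDl mulrDr dotZl mulrA mulfV ?gt_eqF// /bregman.
by rewrite !dotDr !dotNr; lra.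
Qed.

Lemma bregman_ge z x : Qo Q d z -> Q x -> 2^-1 * N (x - z) ^+ 2 <= bregman d d' z x.
Proof.
move=> Qoz Qx; have [_ _ _ dsub _] := dgf.
have := subdiff_strongly_convex cQ (is_dgf_strongly_convex dgf) (dsub _ Qoz) Qx.
by rewrite /bregman; lra.
Qed.

(* One step of the estimate-sequence recursion; [c + dot s _] is the weighted sum of
   the linearizations collected so far, [w] and [a] the old total weight and the
   new weight. *)
Lemma estimate_step (psi : 'rV[R]_k -> R) (G x' z z' p u u' s : 'rV[R]_k)
    (c L L' w a chi : R) :
  0 < L -> 0 < L' -> 0 < w -> 0 < a -> a ^+ 2 <= w + a ->
  is_argmin Q (fun v => c + dot s v + L * d v) z -> Q z' ->
  w * psi u + chi <= c + dot s z + L * d z ->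
  psi x' + dot G (u - x') <= psi u ->
  x' = (a / (w + a)) *: z + (1 - a / (w + a)) *: u ->
  is_prox Q d d' z ((a / L) *: G) p ->
  u' = (a / (w + a)) *: p + (1 - a / (w + a)) *: u ->
  psi u' <= psi x' + dot G (u' - x') + L' / 2 * N (u' - x') ^+ 2 ->
  (w + a) * psi u' + (chi + (L' - L) * (d z' - 2^-1 * N (z - p) ^+ 2)) <=
  c + dot s z' + a * (psi x' + dot G (z' - x')) + L' * d z'.
Proof.
move=> L0 L'0 w0 a0 aw zmin Qz' IH low x'E [Qp pmin] u'E up.
have wa0 : 0 < w + a by lra.
set tau := a / (w + a) in x'E u'E.
have tauE : (w + a) * tau = a by rewrite mulrC divfK// gt_eqF.
have tau0 : 0 < tau by rewrite divr_gt0.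
have du : u' - x' = tau *: (p - z).
  by rewrite u'E x'E opprD addrACA subrr addr0 scalerBr.
have h1 := argmin_bregman L0 zmin Qz'.
have h2 : a * dot G (p - z) + L * bregman d d' z p
    <= a * dot G (z' - z) + L * bregman d d' z z'.
  have La : L * (a / L) = a by rewrite mulrC divfK ?gt_eqF.
  have := pmin _ Qz'.
  by rewrite !dotZl -(ler_pM2l L0) !mulrDr ![L * (a / L * _)]mulrA La.
have h3 := bregman_ge (argmin_Qo L0 zmin) Qp.
(* By [du] the left side carries the factor [(w + a) * tau ^+ 2 = a ^+ 2 / (w + a)], at most 1 by
   [aw]. *)
have h4 : (w + a) * (L' / 2 * N (u' - x') ^+ 2) <= L' / 2 * N (p - z) ^+ 2.
  have [_ _ NZ _] := NN.
  rewrite du NZ (gtr0_norm tau0) exprMn mulrCA ler_pM2l ?divr_gt0//.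
  rewrite mulrA -[leRHS]mul1r ler_wpM2r ?sqr_ge0// expr2 mulrA tauE.
  by rewrite /tau mulrA -expr2 ler_pdivrMr// mul1r.
(* The [u] part is paid for by the old value [w * psi u], the [p] part by the prox inequality
   [h2]. *)
have h5 : (w + a) * dot G (u' - x') = a * dot G (p - x') + w * dot G (u - x').
  have -> : u' - x' = tau *: (p - x') + (1 - tau) *: (u - x').
    by rewrite u'E !segmentE opprB [p - x' + _]addrA subrK addrAC.
  by rewrite (dotDr G (tau *: _)) !dotZr mulrDr mulrA tauE mulrA mulrBr mulr1 tauE addrK.
have h6 : (w + a) * psi u' <= (w + a) * psi x' + (w + a) * dot G (u' - x')
     + (w + a) * (L' / 2 * N (u' - x') ^+ 2) by rewrite -!mulrDr ler_pM2l.
have h7 : w * psi x' + w * dot G (u - x') <= w * psi u by rewrite -mulrDr ler_pM2l.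
have h8 : L * (2^-1 * N (p - z) ^+ 2) <= L * bregman d d' z p by rewrite ler_pM2l.
(* The terms [L * bregman d d' z z'] of [h1] and [h2] cancel. By [h8] the remaining Bregman term
   offsets [L / 2] of the squared norm, so only the share [(L' - L) / 2] is left, which is the
   correction added to [chi]. *)
rewrite (is_normB NN z p) mulrDr; rewrite h5 in h6.
move: h2; rewrite !(dotDr G) !(dotNr G) in h6 h7 *; move=> h2.
by lra.
Qed.

End Prox.

(** * The smoothed primal function *)

Section Smoothing.
Variables (R : realType) (n m : nat).
Variables (N1 : 'rV[R]_n -> R) (N2 : 'rV[R]_m -> R) (Q2 : set 'rV[R]_m).
Variables (f1 : 'rV[R]_n -> R) (g1 : 'rV[R]_n -> 'rV[R]_n) (f2 : 'rV[R]_m -> R).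
Variables (M : R) (A : 'M[R]_(n, m)) (d2 : 'rV[R]_m -> R).
Variables (d2' : 'rV[R]_m -> 'rV[R]_m) (mu : R) (ys : 'rV[R]_n -> 'rV[R]_m).
Hypotheses (NN1 : is_norm N1) (NN2 : is_norm N2) (cQ2 : convex_set Q2).
Hypotheses (cf1 : convex_fun f1) (cf2 : convex_fun f2).
Hypotheses (df1 : forall v, differentiable f1 v)
  (dg1 : forall v h, 'd f1 v h = dot (g1 v) h).
Hypothesis g1M : forall v w, dual_norm N1 (g1 v - g1 w) <= M * N1 (v - w).
Hypotheses (dgf2 : is_dgf N2 Q2 d2 d2') (mu0 : 0 < mu).
Let phi (v : 'rV[R]_n) (w : 'rV[R]_m) := f1 v + dot (v *m A) w - f2 w.
Let phimu v := maxQ Q2 (fun w => phi v w - mu * d2 w).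
Hypothesis ysP : forall v, is_argmax Q2 (fun w => phi v w - mu * d2 w) (ys v).
Let grad v := g1 v + ys v *m A^T.

Lemma smoothedE v : phimu v = phi v (ys v) - mu * d2 (ys v).
Proof. exact: maxQ_argmax. Qed.

(** With the dual point frozen at [ys v] the bilinear term is exactly linear in the primal variable,
    so only [f1] has to be linearized. The right side keeps [ys v], as the later averaging over dual
    points requires. *)
Lemma smoothed_linearization_le v w :
  phimu v + dot (grad v) (w - v) <= phi w (ys v) - mu * d2 (ys v).
Proof.
have := convex_diff_le w cf1 (df1 v); rewrite dg1 smoothedE /phi /grad.
by rewrite dotDl dot_mulmx mulmxBl !dotDl dotNl; lra.
Qed.

Lemma smoothed_gradient_le v w : phimu v + dot (grad v) (w - v) <= phimu w.
Proof.
apply: (le_trans (smoothed_linearization_le v w)); rewrite smoothedE.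
by apply: (ysP w).2; case: (ysP v).
Qed.

Lemma smoothed_descent v w :
  phimu w <= phimu v + dot (grad v) (w - v)
    + (M + op_norm N1 N2 A ^+ 2 / mu) / 2 * N1 (w - v) ^+ 2.
Proof.
have [Qw _] := ysP w.
have sF : strongly_convex_on N2 Q2 (fun y => f2 y - dot (v *m A) y + mu * d2 y) mu.
  move=> x y l Qx Qy l01; have h1 := cf2 x y l01.
  have [_ _ /(_ x y l Qx Qy l01) h2 _ _] := dgf2.
  rewrite -(ler_pM2l mu0) in h2.
  by rewrite dotDr !dotZr; lra.
have ymin : is_argmin Q2 (fun y => f2 y - dot (v *m A) y + mu * d2 y) (ys v).
  have [Qv vmax] := ysP v; split => // y /vmax; rewrite /phi; lra.
have h1 := strongly_convex_argmin cQ2 sF ymin Qw.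
have h2 := descent_lemma v w NN1 df1 dg1 g1M.
have h3 := dot_le_op_norm A (w - v) (ys w - ys v) NN1 NN2.
set a := op_norm N1 N2 A in h3 *; set b := N2 _ in h1 h3; set e := N1 _ in h2 h3 *.
(* Young's inequality, weighted so that the [b] term is exactly the gain from strong convexity in
   [h1]. *)
have h4 : a * e * b <= a ^+ 2 / mu / 2 * e ^+ 2 + mu * (2^-1 * b ^+ 2).
  rewrite -subr_ge0.
  have -> : a ^+ 2 / mu / 2 * e ^+ 2 + mu * (2^-1 * b ^+ 2) - a * e * b
     = (a * e - mu * b) ^+ 2 / (2 * mu) by field; rewrite gt_eqF.
  by rewrite divr_ge0 ?sqr_ge0// mulr_ge0// ltW.
rewrite !smoothedE /phi /grad dotDl dot_mulmx.
move: h3; rewrite dotDr dotNr mulmxBl !dotDl !dotNl => h3.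
have -> : (M + a ^+ 2 / mu) / 2 * e ^+ 2 = M / 2 * e ^+ 2 + a ^+ 2 / mu / 2 * e ^+ 2.
  by ring.
by lra.
Qed.

End Smoothing.

(** * Weighted averages and the duality gap *)

(** Sum the tangent inequalities at the mean [ym]; the linear terms cancel because the weighted
    deviations from [ym] sum to 0. *)
Lemma convex_jensen (R : realType) k (f : 'rV[R]_k -> R) (a : nat -> R)
    (y : nat -> 'rV[R]_k) (r : seq nat) (W : R) :
  convex_fun f -> (forall v, differentiable f v) -> 0 < W ->
  (forall i, 0 <= a i) -> \sum_(i <- r) a i = W ->
  W * f (W^-1 *: \sum_(i <- r) a i *: y i) <= \sum_(i <- r) a i * f (y i).
Proof.
move=> cf df W0 a0 aW; set ym := W^-1 *: _.
have : \sum_(i <- r) a i * (f ym + 'd f ym (y i - ym)) <= \sum_(i <- r) a i * f (y i).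
  by apply: ler_sum => i _; rewrite ler_wpM2l// convex_diff_le.
apply: le_trans; rewrite le_eqVlt; apply/orP; left; apply/eqP.
under [RHS]eq_bigr do rewrite mulrDr.
rewrite big_split/= -mulr_suml aW -[LHS]addr0; congr (_ + _).
under eq_bigr => i _ do rewrite -[_ * _]/(_ *: _) -linearZ/= scalerBr.
rewrite -linear_sum/= big_split/= sumrN -scaler_suml aW.
by rewrite scalerA mulfV ?gt_eqF// scale1r subrr linear0.
Qed.

Lemma sum_weights (R : realType) t :
  \sum_(0 <= k < t.+1) (k.+1%:R / 2) = t.+1%:R * t.+2%:R / 4 :> R.
Proof.
elim: t => [|t IH]; first by rewrite big_nat1; field.
by rewrite big_nat_recr//= IH; field.
Qed.
Theorem theorem4 (R : realType) (n m : nat)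
  (N1 : 'rV[R]_n -> R) (N2 : 'rV[R]_m -> R)
  (Q1 : set 'rV[R]_n) (Q2 : set 'rV[R]_m)
  (f1 : 'rV[R]_n -> R) (g1 : 'rV[R]_n -> 'rV[R]_n) (f2 : 'rV[R]_m -> R)
  (M : R) (A : 'M[R]_(n, m))
  (d1 : 'rV[R]_n -> R) (d1' : 'rV[R]_n -> 'rV[R]_n)
  (d2 : 'rV[R]_m -> R) (d2' : 'rV[R]_m -> 'rV[R]_m)
  (mu : R) (ys : 'rV[R]_n -> 'rV[R]_m)
  (T : nat) (x u z xh : nat -> 'rV[R]_n) (L : nat -> R) :
  is_norm N1 -> is_norm N2 ->
  compact Q1 -> convex_set Q1 -> compact Q2 -> convex_set Q2 ->
  (* f1, f2 smooth convex; g1 is the gradient of f1, Lipschitz with constant M *)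
  convex_fun f1 -> convex_fun f2 ->
  (forall v, differentiable f1 v) -> (forall v h, 'd f1 v h = dot (g1 v) h) ->
  (forall v, differentiable f2 v) ->
  0 < M -> (forall v w, dual_norm N1 (g1 v - g1 w) <= M * N1 (v - w)) ->
  (* distance-generating functions, with min value 0 *)
  is_dgf N1 Q1 d1 d1' -> is_dgf N2 Q2 d2 d2' ->
  (exists c, is_argmin Q1 d1 c /\ d1 c = 0) ->
  (exists c, is_argmin Q2 d2 c /\ d2 c = 0) ->
  0 < mu ->
  let phi := fun (v : 'rV[R]_n) (w : 'rV[R]_m) => f1 v + dot (v *m A) w - f2 w in
  let phibar := fun v => maxQ Q2 (phi v) in
  let phiunder := fun w => minQ Q1 (fun v => phi v w) in
  let phimu := fun v => maxQ Q2 (fun w => phi v w - mu * d2 w) in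
  (* y_*(v) is the maximizer defining phimu v *)
  (forall v, is_argmax Q2 (fun w => phi v w - mu * d2 w) (ys v)) ->
  let grad := fun v => g1 v + ys v *m A^T in
  let nA := op_norm N1 N2 A in
  let Lmu := M + nA ^+ 2 / mu in
  (* the algorithm *)
  L 0%N = Lmu ->
  is_argmin Q1 d1 (x 0%N) ->
  is_argmin Q1 (fun v => 2^-1 * (phimu (x 0%N) + dot (grad (x 0%N)) (v - x 0%N))
                         + L 0%N * d1 v) (u 0%N) ->
  z 0%N = u 0%N ->
  x 1%N = (2 / 3 : R) *: z 0%N + (1 - 2 / 3 : R) *: u 0%N ->
  is_prox Q1 d1 d1' (z 0%N) ((L 0%N)^-1 *: grad (x 1%N)) (xh 1%N) ->
  u 1%N = (2 / 3 : R) *: xh 1%N + (1 - 2 / 3 : R) *: u 0%N ->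
  (forall t : nat, (1 <= t <= T)%N ->
     (0 < L t <= Lmu) /\
     [/\ phimu (u t) <= phimu (x t) + dot (grad (x t)) (u t - x t)
                        + L t / 2 * N1 (u t - x t) ^+ 2,
         is_argmin Q1 (fun v => \sum_(0 <= k < t.+1)
                         (k.+1%:R / 2) * (phimu (x k) + dot (grad (x k)) (v - x k))
                         + L t * d1 v) (z t),
         x t.+1 = (2 / t.+3%:R) *: z t + (1 - 2 / t.+3%:R) *: u t,
         is_prox Q1 d1 d1' (z t) ((t.+2%:R / 2 / L t) *: grad (x t.+1)) (xh t.+1)
       & u t.+1 = (2 / t.+3%:R) *: xh t.+1 + (1 - 2 / t.+3%:R) *: u t]) ->
  let xbar := u T in
  let ybar := \sum_(0 <= t < T.+1)
                ((2 * t.+1%:R) / (T.+1%:R * T.+2%:R)) *: ys (x t) in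
  let chi := \sum_(0 <= t < T)
               (L t.+1 - L t) * (d1 (z t.+1) - 2^-1 * N1 (z t - xh t.+1) ^+ 2) in
  let D1 := maxQ Q1 d1 in
  let D2 := maxQ Q2 d2 in
  phibar xbar - phiunder ybar
    <= 4 * (D1 * nA ^+ 2 / mu + D1 * M - chi) / (T.+1%:R ^+ 2) + mu * D2.
Proof.
move=> NN1 NN2 kQ1 cQ1 kQ2 cQ2 cf1 cf2 df1 dg1 df2 M0 g1M dgf1 dgf2 [c1 [c1min d1c1]] _.
move=> mu0 phi phibar phiunder phimu ysP grad nA Lmu L0E x0min u0min z0E x1E xh1 u1E alg.
pose xbar := u T.
pose ybar := \sum_(0 <= t < T.+1) ((2 * t.+1%:R) / (T.+1%:R * T.+2%:R)) *: ys (x t).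
pose chi := \sum_(0 <= t < T)
  (L t.+1 - L t) * (d1 (z t.+1) - 2^-1 * N1 (z t - xh t.+1) ^+ 2).
pose D1 := maxQ Q1 d1; pose D2 := maxQ Q2 d2.
change (phibar xbar - phiunder ybar
  <= 4 * (D1 * nA ^+ 2 / mu + D1 * M - chi) / (T.+1%:R ^+ 2) + mu * D2).
have low v w : phimu v + dot (grad v) (w - v) <= phimu w.
  exact: (smoothed_gradient_le cf1 df1 dg1 ysP).
have Lmu0 : 0 < Lmu by rewrite ltr_wpDr// divr_ge0 ?sqr_ge0// ltW.
have Lb t : (t <= T)%N -> 0 < L t <= Lmu.
  by case: t => [|t tT]; [rewrite L0E Lmu0 lexx | have [] := alg t.+1 tT].
pose s t := \sum_(0 <= k < t.+1) (k.+1%:R / 2) *: grad (x k).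
pose c t := \sum_(0 <= k < t.+1) k.+1%:R / 2 * (phimu (x k) - dot (grad (x k)) (x k)).
have sumE t v : \sum_(0 <= k < t.+1)
    (k.+1%:R / 2) * (phimu (x k) + dot (grad (x k)) (v - x k)) = c t + dot (s t) v.
  rewrite dot_suml -big_split/=; apply: eq_bigr => k _.
  by rewrite dotZl dotDr dotNr; ring.
have zmin t : (t <= T)%N ->
    is_argmin Q1 (fun v => c t + dot (s t) v + L t * d1 v) (z t).
  case: t => [_|t tT].
    have [Qu umin] := u0min; rewrite z0E; split => // y /umin.
    by rewrite -!sumE !big_nat1 !mul1r.
  have [_ [_ [Qz zm] _ _ _]] := alg t.+1 tT.
  by split => // y /zm; rewrite -!sumE.
(* The separately stated initialization is the case [t = 0] of the general update, as [2 / 2 / L 0]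
   is the inverse of [L 0]. *)
have step t : (t < T)%N -> [/\ x t.+1 = (2 / t.+3%:R) *: z t + (1 - 2 / t.+3%:R) *: u t,
    is_prox Q1 d1 d1' (z t) ((t.+2%:R / 2 / L t) *: grad (x t.+1)) (xh t.+1)
  & u t.+1 = (2 / t.+3%:R) *: xh t.+1 + (1 - 2 / t.+3%:R) *: u t].
  case: t => [_|t tT]; last by have [_ [_ _ ? ? ?]] := alg t.+1 (ltnW tT).
  by split => //; rewrite divff ?pnatr_eq0// mul1r.
pose W t : R := t.+1%:R * t.+2%:R / 4.
pose X t := \sum_(0 <= k < t)
   (L k.+1 - L k) * (d1 (z k.+1) - 2^-1 * N1 (z k - xh k.+1) ^+ 2).
have inv t : (t <= T)%N -> Q1 (u t) /\
    W t * phimu (u t) + X t <= c t + dot (s t) (z t) + L t * d1 (z t).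
  elim: t => [_|t IH tT].
    have [Qu _] := u0min; split => //.
    have up : phimu (u 0%N) <= phimu (x 0%N) + dot (grad (x 0%N)) (u 0%N - x 0%N)
        + Lmu / 2 * N1 (u 0%N - x 0%N) ^+ 2.
      exact: (smoothed_descent NN1 NN2 cQ2 cf2 df1 dg1 g1M dgf2 mu0 ysP).
    have := strongly_convex_argmin cQ1 (is_dgf_strongly_convex dgf1) x0min Qu.
    have -> : d1 (x 0%N) = 0.
      apply/eqP; rewrite eq_le; apply/andP; split.
        by rewrite -d1c1; apply: x0min.2; case: c1min.
      by case: dgf1 => d10 _ _ _ _; apply: d10; case: x0min.
    rewrite mul1r add0r -(ler_pM2l Lmu0) => h.
    (* Since [W 0 = 1/2], the descent bound costs only [Lmu / 4] times the squared norm, while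
       [Lmu * d1 (u 0)] provides [Lmu / 2]; this sign covers the slack. *)
    have : 0 <= Lmu * N1 (u 0%N - x 0%N) ^+ 2 by rewrite mulr_ge0 ?sqr_ge0// ltW.
    rewrite /X big_geq// addr0 -sumE big_nat1 z0E L0E /W.
    by lra.
  have [Qu IHt] := IH (ltnW tT).
  have [x'E xhp u'E] := step t tT.
  have /andP[Lt0 _] := Lb t (ltnW tT).
  have /andP[Lt'0 _] := Lb t.+1 tT.
  have [_ [up _ _ _ _]] := alg t.+1 tT.
  have [Qz' _] := zmin t.+1 tT.
  have [Qxh _] := xhp.
  split.
    rewrite u'E; apply: convex_setP => //; rewrite divr_ge0//=.
    by rewrite ler_pdivrMr// mul1r ler_nat.
  have Wt0 : 0 < W t by rewrite /W divr_gt0// mulr_gt0.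
  (* The weight of the next linearization: [a / W t.+1] is the step size [2 / (t + 3)], and
     [a ^+ 2 <= W t.+1] amounts to [t + 2 <= t + 3]. *)
  pose a : R := t.+2%:R / 2.
  have a0 : 0 < a by rewrite divr_gt0.
  have WE : W t + a = W t.+1 by rewrite /W /a; field.
  have tauE : a / (W t + a) = 2 / t.+3%:R.
    rewrite WE /a /W; field.
    by have ? : 0 <= t%:R :> R by []; apply/andP; split; lra.
  have aW : a ^+ 2 <= W t + a.
    rewrite WE /a /W; have : 0 <= t%:R :> R by []; nra.
  rewrite -tauE in x'E u'E.
  have key := estimate_step NN1 cQ1 kQ1 dgf1 Lt0 Lt'0 Wt0 a0 aW (zmin t (ltnW tT))
    Qz' IHt (low _ _) x'E xhp u'E up.
  by rewrite WE in key; rewrite -sumE big_nat_recr//= sumE /X big_nat_recr.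
have D1ge v : Q1 v -> d1 v <= D1 by case: dgf1 => _ dc _ _ _; exact: le_maxQ.
have D2ge w : Q2 w -> d2 w <= D2 by case: dgf2 => _ dc _ _ _; exact: le_maxQ.
have d2ge w : Q2 w -> 0 <= d2 w by case: dgf2 => d0 _ _ _ _; exact: d0.
have [QuT invT] := inv T (leqnn T).
have WT0 : 0 < W T by rewrite /W divr_gt0// mulr_gt0.
have main v : Q1 v -> W T * phimu xbar + chi <= \sum_(0 <= k < T.+1)
    (k.+1%:R / 2) * (phimu (x k) + dot (grad (x k)) (v - x k)) + Lmu * D1.
  move=> Qv; rewrite sumE; apply: (le_trans invT).
  have [_ /(_ v Qv) h] := zmin T (leqnn T); apply: (le_trans h); rewrite lerD2l.
  have /andP[LT0 LTl] := Lb T (leqnn T).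
  have d1v : 0 <= d1 v by case: dgf1 => d0 _ _ _ _; exact: d0.
  by rewrite ler_pM ?D1ge// ltW.
have chiD : chi <= Lmu * D1.
  have h := main _ QuT.
  suff : \sum_(0 <= k < T.+1) (k.+1%:R / 2) *
      (phimu (x k) + dot (grad (x k)) (xbar - x k)) <= W T * phimu xbar by lra.
  rewrite /W -sum_weights mulr_suml.
  by apply: ler_sum => k _; rewrite ler_wpM2l// divr_ge0.
have ybarE : ybar = (W T)^-1 *: \sum_(0 <= k < T.+1) (k.+1%:R / 2) *: ys (x k).
  rewrite scaler_sumr; apply: eq_bigr => k _; rewrite scalerA; congr (_ *: _).
  by rewrite /W; field; have ? : 0 <= T%:R :> R by []; apply/andP; split; lra.
(* For fixed [v], only [- f2] is not affine in the dual variable, so Jensen is applied to [f2]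
   alone. *)
have phi_avg v : \sum_(0 <= k < T.+1) (k.+1%:R / 2) * phi v (ys (x k)) <= W T * phi v ybar.
  have w0 i : 0 <= i.+1%:R / 2 :> R by rewrite divr_ge0.
  have := convex_jensen (fun k => ys (x k)) cf2 df2 WT0 w0 (sum_weights R T).
  rewrite -ybarE => h.
  have -> : \sum_(0 <= k < T.+1) (k.+1%:R / 2) * phi v (ys (x k)) =
      W T * f1 v + W T * dot (v *m A) ybar
      - \sum_(0 <= k < T.+1) (k.+1%:R / 2) * f2 (ys (x k)).
    rewrite ybarE dotZr mulrA mulfV ?gt_eqF// mul1r dot_sumr.
    rewrite {1}/W -sum_weights mulr_suml -big_split -sumrB/=.
    by apply: eq_bigr => k _; rewrite dotZr /phi; ring.
  by rewrite /phi; lra.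
(* The estimate [main] holds for every [v] in [Q1], hence passes to the infimum; the terms
   [- mu * d2] are dropped by sign. *)
have under : phimu xbar - (Lmu * D1 - chi) / W T <= phiunder ybar.
  apply: lb_le_inf; first by exists (phi xbar ybar), xbar.
  move=> _ [v Qv <-]; rewrite -(ler_pM2l WT0) mulrBr mulrCA mulfV ?gt_eqF// mulr1.
  apply: le_trans (phi_avg v); rewrite opprB addrA lerBlDr; apply: (le_trans (main v Qv)).
  rewrite lerD2r; apply: ler_sum => k _; rewrite ler_wpM2l ?divr_ge0//.
  apply: (le_trans (smoothed_linearization_le cf1 df1 dg1 ysP _ _)).
  by rewrite gerBl mulr_ge0 ?(ltW mu0)// d2ge//; case: (ysP (x k)).
have over : phibar xbar <= phimu xbar + mu * D2.
  apply: ge_sup; first by exists (phi xbar (ys xbar)), (ys xbar) => //; case: (ysP xbar).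
  move=> _ [w Qw <-].
  have h1 : phi xbar w - mu * d2 w <= phimu xbar.
    by rewrite /phimu (maxQ_argmax (ysP xbar)); apply: (ysP xbar).2.
  have h2 : mu * d2 w <= mu * D2 by rewrite ler_pM2l// D2ge.
  by lra.
have -> : 4 * (D1 * nA ^+ 2 / mu + D1 * M - chi) / T.+1%:R ^+ 2
    = (Lmu * D1 - chi) * (4 / T.+1%:R ^+ 2).
  by rewrite /Lmu; field; have ? : 0 <= T%:R :> R by []; apply/andP; split; lra.
suff : (Lmu * D1 - chi) / W T <= (Lmu * D1 - chi) * (4 / T.+1%:R ^+ 2).
  move: under; set q := _ / W T; set r := _ * (4 / _).
  by move: q r (phiunder ybar) => q r p; lra.
rewrite ler_wpM2l ?subr_ge0// /W invf_div ler_pM2l// lef_pV2 ?posrE ?mulr_gt0//.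
by rewrite expr2 ler_pM2l// ler_nat.
Qed.
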